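(* There is an absolute constant $C>0$ such that for every $n$ and every graph $H\subseteq K_n$ with at least one edge, the uniform probability measure $\nu_H$ on the copies of $H$ in $K_n$ is $C\,\Delta(H)^{2/d_*(H)}\,q_H$-spread.
   Context: All graphs are finite and simple; $v(G)$ and $e(G)$ are the numbers of vertices and edges of $G$, and $\Delta(G)$ is its maximum degree. A graph is nonempty if it has at least one edge. Isolated vertices are omitted, so a subgraph is identified with its edge set together with the endpoints of these edges; subgraphs need not be induced or connected. The maximum subgraph average degree is $d_*(H):=\max_{\varnothing\ne J\subseteq H}\frac{2e(J)}{v(J)}$, over nonempty subgraphs $J$ of $H$. A copy of $H$ in $K_n$ is a subgraph of $K_n$ isomorphic to $H$, and $N_I(G)$ denotes the number of copies of $I$ in $G$. $\nu_H$ is the uniform probability measure on the copies of $H$ in $K_n$. For nonempty $H\subseteq K_n$, $$q_H:=\max_{\varnothing\ne I\subseteq H}N_I(K_n)^{-1/e(I)},$$ the maximum being over all nonempty subgraphs $I$ of $H$. A probability measure $\mu$ on subgraphs of $K_n$ is $a$-spread if $\mu(\{S:A\subseteq E(S)\})\le a^{|A|}$ for every nonempty edge set $A\subseteq E(K_n)$. *)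

(* Defs.v *)
From mathcomp Require Import all_boot all_order all_algebra.
From mathcomp Require Import reals exp.

Set Implicit Arguments.
Unset Strict Implicit.
Unset Printing Implicit Defensive.

Import Order.TTheory GRing.Theory Num.Theory.
Local Open Scope ring_scope.

(** A graph on vertices in ['I_n] without isolated vertices is identified with
    its edge set, a set of two-element subsets of ['I_n].  The subgraphs of
    [K_n] are thus the [H : edgeset n] with [H \subset complete n]. *)
Notation edgeset n := {set {set 'I_n}}.

Definition complete (n : nat) : edgeset n := [set e : {set 'I_n} | #|e| == 2%N].

Section Graphs.
Variable n : nat.
Implicit Types G H I J : edgeset n.

Definition vertices G : {set 'I_n} := cover G.

Definition degree G (v : 'I_n) : nat := #|[set e in G | v \in e]|.

Definition max_degree G : nat := (\max_(v in vertices G) degree G v)%N.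

(** [f] is total, but only its restriction to [vertices I] matters. *)
Definition is_isomorphism I J (f : {ffun 'I_n -> 'I_n}) : bool :=
  [&& [forall x in vertices I, forall y in vertices I, (f x == f y) ==> (x == y)],
      f @: vertices I == vertices J
    & [forall x in vertices I, forall y in vertices I,
        ([set x; y] \in I) == ([set f x; f y] \in J)]].

Definition isomorphic I J : bool := [exists f, is_isomorphism I J f].

Definition copies I G : {set edgeset n} :=
  [set J : edgeset n | (J \subset G) && isomorphic I J].

Definition num_copies I G : nat := #|copies I G|.

Variable R : realType.

(** In both maxima below all terms are positive, so the default value [0] is
    irrelevant as soon as [H] is nonempty. *)
Definition max_avg_degree H : R :=
  \big[Num.max/0]_(J : edgeset n | (J \subset H) && (J != set0))
     ((2 * #|J|)%N%:R / #|vertices J|%:R).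

Definition q H : R :=
  \big[Num.max/0]_(I : edgeset n | (I \subset H) && (I != set0))
     ((num_copies I (complete n))%:R `^ (- (#|I|%:R)^-1)).

(** Measures on the finite set of subgraphs of [K_n] are given by their
    mass functions. *)
Definition is_probability (mu : edgeset n -> R) : Prop :=
  [/\ forall S, 0 <= mu S,
      forall S : edgeset n, ~~ (S \subset complete n) -> mu S = 0
    & \sum_S mu S = 1].

Definition spread (a : R) (mu : edgeset n -> R) : Prop :=
  is_probability mu /\
  forall A : edgeset n, A \subset complete n -> A != set0 ->
    \sum_(S : edgeset n | A \subset S) mu S <= a ^+ #|A|.

Definition nu H : edgeset n -> R := fun S =>
  if S \in copies H (complete n) then (num_copies H (complete n))%:R^-1 else 0.

End Graphs.

Arguments max_avg_degree {n} R H.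
Arguments q {n} R H.
Arguments nu {n} R H.

(* Main.v *)
(** By symmetry, the probability that a random copy of [H] contains [A] is the
    probability that a random permutation maps [A] into [H], which is at most
    [e^v(A) t(A)], where [t(A)] is the probability that a uniform random map
    ['I_n -> 'I_n] is injective on the vertices of [A] and maps [A] into [H].
    Since [t] is submultiplicative over vertex-disjoint unions, it suffices to
    bound [t(B) <= (C Q)^e(B)] for [B] connected with [v] vertices, where
    [D := max_degree H], [d := max_avg_degree H] and [Q := D^(2/d) q].
    - If [2e(B)/d <= v - 1]: exploring [B] vertex by vertex gives
      [t(B) <= (D/n)^(v-1)], while testing [q] on a densest subgraph of [H] gives
      [Q >= (D/n)^(2/d)].
    - Otherwise [Q^e(B) >= D^(v-1) q^e(B)].  Take a maximal family of [k]
      vertex-disjoint copies of [B] in [H], with union [I].  Every copy of [B] in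
      [H] meets [I], so that [t(B) <= k v^2 D^(v-1) / n^v]; and [K_n] contains at
      most ['C(n^v, k) <= (e n^v / k)^k] copies of [I], so that
      [q^e(B) >= k / (e n^v)]. *)
Require Import Defs.
From mathcomp Require Import all_boot all_order all_algebra.
From mathcomp Require Import all_fingroup unstable reals sequences exp ring.

Set Implicit Arguments.
Unset Strict Implicit.
Unset Printing Implicit Defensive.

Import Order.TTheory GRing.Theory Num.Theory.
Local Open Scope ring_scope.

(** * Counting maps by resampling one value *)

Section Resampling.
Variables (T U : finType).
Implicit Types (f g : {ffun T -> U}) (P Q : {set {ffun T -> U}}).

Definition update f y z : {ffun T -> U} := [ffun x => if x == y then z else f x].

Lemma update_update f y z w : update (update f y z) y w = update f y w.
Proof. by apply/ffunP => x; rewrite !ffunE; case: eqP. Qed.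

Lemma update_id f y : update f y (f y) = f.
Proof. by apply/ffunP => x; rewrite ffunE; case: eqP => // ->. Qed.

(* Double counting of the pairs [(f, z)] with [f \in P] and [update f y z \in Q]. *)
Lemma card_update (y : T) P Q (D : nat) :
  (forall f z, f \in Q -> update f y z \in P) ->
  (forall f, #|[set z | update f y z \in Q]| <= D)%N ->
  (#|U| * #|Q| <= D * #|P|)%N.
Proof.
move=> QP QD.
(* Overwriting the value at [y] while recording the old one is injective, since the old value can be
   restored. *)
pose h (p : U * {ffun T -> U}) := (update p.2 y p.1, p.2 y).
pose Z := [set p : {ffun T -> U} * U | (p.1 \in P) && (update p.1 y p.2 \in Q)].
have hinj : injective h.
  move=> [w f] [w' f'] [/= eqf eqy].
  have -> : w = w' by move/ffunP/(_ y): eqf; rewrite !ffunE eqxx.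
  by rewrite -(update_id f y) -(update_update f y w) eqf eqy update_update update_id.
have -> : (#|U| * #|Q| = #|h @: setX setT Q|)%N.
  by rewrite card_imset // cardsX cardsT.
have /subset_leq_card/leq_trans -> // : h @: setX setT Q \subset Z.
  apply/subsetP => _ /imsetP[[w f] /setXP[_ fQ] ->].
  by rewrite inE /= QP //= update_update update_id.
have -> : (#|Z| = \sum_(f in P) #|[set z | update f y z \in Q]|)%N.
  rewrite -sum1_card (eq_bigl _ _ (in_set _)).
  rewrite -(pair_big_dep (fun f => f \in P) (fun f z => update f y z \in Q) (fun _ _ => 1%N)) /=.
  by apply: eq_bigr => f _; rewrite -sum1_card; apply: eq_bigl => z; rewrite inE.
by rewrite mulnC -sum_nat_const leq_sum.
Qed.

End Resampling.

(** * Maps sending one graph into another *)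

Section Embeddings.
Variable n : nat.
Implicit Types (A B H I J : edgeset n) (S V : {set 'I_n}) (f g : {ffun 'I_n -> 'I_n}).

Definition image_graph (f : 'I_n -> 'I_n) A : edgeset n := [set f @: e | e : {set 'I_n} in A].

(** [S] is kept apart from [A] so that it can grow from [vertices A], the case of embeddings, to
    [setT], where the maps are permutations. *)
Definition inj_homs H S A : {set {ffun 'I_n -> 'I_n}} :=
  [set f : {ffun 'I_n -> 'I_n} | (#|f @: S| == #|S|) && (image_graph f A \subset H)].

(** Maps are total, so [#|embeddings H A| / n ^ n] is the probability [t(A)]. *)
Definition embeddings H A := inj_homs H (vertices A) A.

Lemma mem_vertices A e x : e \in A -> x \in e -> x \in vertices A.
Proof. by move=> eA xe; apply/bigcupP; exists e. Qed.

Lemma eq_image_graph (f g : 'I_n -> 'I_n) A :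
  {in vertices A, f =1 g} -> image_graph f A = image_graph g A.
Proof.
move=> fg; apply: eq_in_imset => e eA; apply: eq_in_imset => x xe.
by apply: fg; apply: mem_vertices xe.
Qed.

Lemma image_graph_comp (f g : 'I_n -> 'I_n) A :
  image_graph (f \o g) A = image_graph f (image_graph g A).
Proof.
by rewrite /image_graph -imset_comp; apply: eq_imset => e /=; rewrite -imset_comp.
Qed.

Lemma image_graph_id A : image_graph id A = A.
Proof.
rewrite /image_graph -[RHS]imset_id; apply: eq_imset => e; exact: imset_id.
Qed.

Lemma image_graphS (f : 'I_n -> 'I_n) A B :
  A \subset B -> image_graph f A \subset image_graph f B.
Proof. exact: imsetS. Qed.

Lemma vertices_image (f : 'I_n -> 'I_n) A :
  vertices (image_graph f A) = f @: vertices A.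
Proof.
apply/setP => y; apply/bigcupP/imsetP.
  case=> _ /imsetP[e eA ->] /imsetP[x xe ->]; exists x => //.
  exact: mem_vertices xe.
case=> x /bigcupP[e eA xe] ->; exists (f @: e); exact: imset_f.
Qed.

Lemma vertices_le A : A \subset complete n -> (#|vertices A| <= 2 * #|A|)%N.
Proof.
move=> Ac; rewrite /vertices; apply: leq_trans (leq_card_cover _) _.
rewrite mulnC -sum_nat_const leq_sum // => e eA.
by move/subsetP: Ac => /(_ e eA); rewrite inE => /eqP->.
Qed.

Lemma edge_eq A e x : A \subset complete n -> e \in A -> x \in e ->
  exists2 y, x != y & e = [set x; y].
Proof.
move=> /subsetP Ac /Ac; rewrite inE => /cards2P[a [b [ab ->]]] /set2P[]->.
  by exists b.
by exists a; rewrite 1?eq_sym // setUC.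
Qed.

(** The value at [y] must avoid the [#|S|] distinct values taken on [S], which leaves [n - #|S|]
    choices out of [n]. *)
Lemma inj_homs_step H S A y : y \notin S -> vertices A \subset S ->
  (n * #|inj_homs H (y |: S) A| <= (n - #|S|) * #|inj_homs H S A|)%N.
Proof.
move=> yS AS; rewrite -{1}(card_ord n); apply: (card_update (y := y)).
  move=> f z; rewrite !inE => /andP[/imset_injP finj fA].
  have updE : {in S, update f y z =1 f}.
    by move=> x xS; rewrite ffunE; case: eqP => // xy; rewrite -xy xS in yS.
  apply/andP; split.
    apply/imset_injP => u v uS vS; rewrite !updE // => /finj; apply; exact: setU1r.
  rewrite (eq_image_graph (g := f)) // => x xA; apply: updE.
  exact: (subsetP AS).
move=> f; set Z := [set _ | _].
have [->|[z0 z0Z]] := set_0Vmem Z; first by rewrite cards0.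
have Scard : #|update f y z0 @: S| = #|S|.
  move: z0Z; rewrite !inE => /andP[/imset_injP uinj _].
  by apply: card_in_imset => u v uS vS; apply: uinj; apply: setU1r.
have SE z : update f y z @: S = f @: S.
  by apply: eq_in_imset => x xS; rewrite ffunE; case: eqP => // xy; rewrite -xy xS in yS.
have -> : (n - #|S| = #|~: (f @: S)|)%N by rewrite [RHS]cardsCs setCK card_ord -Scard SE.
apply: subset_leq_card; apply/subsetP => z; rewrite !inE => /andP[/imset_injP uinj _].
apply: contra yS; rewrite -(SE z) => /imsetP[x xS].
rewrite [update f y z x]ffunE; case: eqP => [<-//|xy zE].
suff : y = x by move=> yx; rewrite yx in xy.
apply: uinj; rewrite ?setU11 ?setU1r // !ffunE eqxx.
by case: eqP => // _.
Qed.

(** Adding the other vertices one at a time multiplies the factors [n - #|S|] into a factorial. With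
    [v] vertices in [A], a random permutation thus maps [A] into [H] with probability at most
    [n ^ v / n ^_ v] times [t(A)]. *)
Lemma inj_homs_setT H A :
  (n ^ (n - #|vertices A|) * #|inj_homs H setT A|
     <= (n - #|vertices A|)`! * #|embeddings H A|)%N.
Proof.
suff main m S : vertices A \subset S -> (#|S| + m = n)%N ->
    (n ^ m * #|inj_homs H setT A| <= m`! * #|inj_homs H S A|)%N.
  by apply: main => //; rewrite subnKC // -[X in (_ <= X)%N]card_ord max_card.
elim: m S => [|m IHm] S AS Sm.
  rewrite expn0 fact0 !mul1n; suff -> : S = setT by [].
  by apply/eqP; rewrite eqEcard subsetT cardsT card_ord -[X in (X <= _)%N]Sm addn0 leqnn.
have /set0Pn[y] : ~: S != set0.
  by rewrite -card_gt0 cardsCs setCK card_ord -[X in (X - _)%N]Sm addKn.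
rewrite inE => yS.
have /(IHm _ (subset_trans AS (subsetUr _ _))) IH : (#|y |: S| + m = n)%N.
  by rewrite cardsU1 yS add1n addSn -addnS.
have := inj_homs_step H yS AS.
have -> : (n - #|S| = m.+1)%N by rewrite -[X in (X - _)%N]Sm addKn.
move=> step.
rewrite expnS -mulnA; apply: leq_trans (leq_mul (leqnn n) IH) _.
rewrite mulnCA; apply: leq_trans (leq_mul (leqnn _) step) _.
by rewrite mulnA factS [(m.+1 * _)%N]mulnC.
Qed.

(** The conditions on [A] and on [B] read disjoint sets of coordinates, hence are independent;
    forgetting injectivity across the two parts gives the inequality. *)
Lemma embeddings_disjoint H A B : [disjoint vertices A & vertices B] ->
  (n ^ n * #|embeddings H (A :|: B)| <= #|embeddings H A| * #|embeddings H B|)%N.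
Proof.
move=> dAB.
(* Exchange the values of two maps on the vertices of [A]. *)
pose h (p : {ffun 'I_n -> 'I_n} * {ffun 'I_n -> 'I_n}) :=
  ([ffun x => if x \in vertices A then p.2 x else p.1 x] : {ffun 'I_n -> 'I_n},
   [ffun x => if x \in vertices A then p.1 x else p.2 x] : {ffun 'I_n -> 'I_n}).
have hinj : injective h.
  by apply: (can_inj (g := h)) => -[f g]; congr pair; apply/ffunP => x;
     rewrite !ffunE /= ?ffunE; case: (x \in _).
have -> : (n ^ n = #|[set: {ffun 'I_n -> 'I_n}]|)%N by rewrite cardsT card_ffun card_ord.
rewrite -!cardsX -(card_imset _ hinj); apply: subset_leq_card.
apply/subsetP => y /imsetP[[f g] /setXP[_]] /=.
rewrite inE => /andP[/imset_injP ginj gAB] ->{y}; rewrite inE /=.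
have part (C : edgeset n) (k : {ffun 'I_n -> 'I_n}) :
    C \subset A :|: B -> {in vertices C, k =1 g} -> k \in embeddings H C.
  move=> CAB kg; rewrite inE (eq_image_graph kg).
  rewrite (subset_trans _ gAB) ?image_graphS // andbT.
  have VC : {subset vertices C <= vertices (A :|: B)}.
    move=> x /bigcupP[e eC xe]; apply: mem_vertices xe; exact: (subsetP CAB).
  by apply/imset_injP => u v uC vC; rewrite !kg // => /ginj; apply; apply: VC.
have -> := part A _ (subsetUl _ _) _.
  have -> // := part B _ (subsetUr _ _) _.
  by move=> x xB; rewrite ffunE (disjointFl dAB).
by move=> x xA; rewrite ffunE xA.
Qed.

End Embeddings.

(** * Components, and exploration of a connected graph *)

Section Growth.
Variable n : nat.
Implicit Types (A B H I J : edgeset n) (S T V : {set 'I_n}) (f g : {ffun 'I_n -> 'I_n}).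

Lemma card_neighbours H a : (#|[set z | [set a; z] \in H]| <= max_degree H)%N.
Proof.
set Z := [set _ | _].
have [->|[z0]] := set_0Vmem Z; first by rewrite cards0.
rewrite inE => z0H.
have aH : a \in vertices H by apply: mem_vertices z0H _; rewrite set21.
apply: leq_trans (leq_bigmax_cond a aH).
rewrite /degree -(card_imset (f := fun z => [set a; z])); last first.
  move=> z z' /setP eqz; have := eqz z; rewrite set22 => /esym/set2P[za|//].
  by have := eqz z'; rewrite set22 za => /set2P[]->.
apply/subset_leq_card/subsetP => _ /imsetP[z zZ ->].
by rewrite !inE eqxx /=; rewrite inE in zZ; rewrite zZ.
Qed.

Lemma max_degree_le H : H \subset complete n -> (max_degree H <= n)%N.
Proof.
move=> Hc; apply/bigmax_leqP => v _.
have : [set e in H | v \in e] \subset [set [set v; z] | z : 'I_n].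
  apply/subsetP => e; rewrite inE => /andP[eH ve].
  by have [y _ ->] := edge_eq Hc eH ve; apply: imset_f.
move=> /subset_leq_card/leq_trans; apply.
by rewrite -[X in (_ <= X)%N]card_ord leq_imset_card.
Qed.

Lemma max_degree_gt0 H : H \subset complete n -> H != set0 -> (0 < max_degree H)%N.
Proof.
move=> Hc /set0Pn[e eH]; have := subsetP Hc e eH; rewrite inE => /cards2P[a [b [_ eE]]].
have aH : a \in vertices H by apply: mem_vertices eH _; rewrite eE set21.
apply: leq_trans (leq_bigmax_cond a aH).
by rewrite card_gt0; apply/set0Pn; exists e; rewrite inE eH eE set21.
Qed.

(* Connectedness, in the form of an edge crossing every cut. *)
Definition cut_connected B := forall S, S \subset vertices B -> S != vertices B -> S != set0 ->
  exists x y, [/\ x \in S, y \notin S & [set x; y] \in B].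

(** [B] is a minimal nonempty set of edges sharing no vertex with the other edges of [A]. *)
Lemma exists_component A : A \subset complete n -> A != set0 ->
  exists B, [/\ B \subset A, B != set0, cut_connected B
              & [disjoint vertices B & vertices (A :\: B)]].
Proof.
move=> Ac A0.
pose P B := [&& B \subset A, B != set0 & [disjoint vertices B & vertices (A :\: B)]].
have PA : P A.
  by rewrite /P subxx A0 /= setDv /vertices /cover big_set0 disjoint_sym disjoints_subset sub0set.
have [B /minsetP[/and3P[BA B0 dB] Bmin] _] := minset_exists PA.
exists B; split=> // S SB SnB /set0Pn[x0 x0S].
have [/existsP[x /existsP[y /and3P[]]]|nocut] :=
  boolP [exists x, exists y, [&& x \in S, y \notin S & [set x; y] \in B]].
  by exists x, y.
have closedS e : e \in B -> (exists2 x, x \in e & x \in S) -> e \subset S.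
  move=> eB [x xe xS]; have [y _ eE] := edge_eq (subset_trans BA Ac) eB xe.
  apply/subsetP => z; rewrite eE => /set2P[->//|->]; apply: contraNT nocut => yS.
  by apply/existsP; exists x; apply/existsP; exists y; rewrite xS yS -eE eB.
(* If no edge crosses [S], the edges inside [S] share no vertex with the rest either, so by
   minimality they are all of [B]. *)
pose B' := [set e in B | e \subset S].
have B'B : B' \subset B by apply/subsetP => e; rewrite inE => /andP[].
case/eqP: SnB; apply/eqP; rewrite eqEsubset SB.
suff -> : B = B' by apply/bigcupsP => e; rewrite inE => /andP[].
apply/esym/Bmin => //; apply/and3P; split; first exact: subset_trans BA.
  have /bigcupP[e eB x0e] := subsetP SB _ x0S.
  by apply/set0Pn; exists e; rewrite inE eB closedS //; exists x0.
rewrite disjoints_subset; apply/subsetP => x /bigcupP[e]; rewrite inE => /andP[eB eS] xe.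
rewrite inE; apply/bigcupP => -[e' /setDP[e'A e'B'] xe'].
have [e'B|e'B] := boolP (e' \in B).
  case/negP: e'B'; rewrite inE e'B closedS //; exists x => //; exact: (subsetP eS).
have xB : x \in vertices B by apply: mem_vertices xe.
have := disjointFr dB xB; rewrite (mem_vertices (e := e')) //.
by rewrite inE e'B.
Qed.

(** Each new vertex is adjacent to an explored one, so its image has at most [max_degree H] choices;
    the root [x0] has [#|T|]. *)
Lemma homs_growth H B x0 T : cut_connected B -> x0 \in vertices B ->
  (n ^ #|vertices B| *
     #|[set f : {ffun 'I_n -> 'I_n} | (f x0 \in T) && (image_graph f B \subset H)]|
    <= #|T| * max_degree H ^ #|vertices B|.-1 * n ^ n)%N.
Proof.
move=> Bconn x0B.
(* Only edges inside the explored set [S] are tested; at [S = vertices B] all of them are. *)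
pose P S := [set f : {ffun 'I_n -> 'I_n} | (f x0 \in T) &&
  [forall e in B, (e \subset S) ==> (f @: e \in H)]].
have main j : (j < #|vertices B|)%N -> exists S, [/\ x0 \in S, S \subset vertices B, #|S| = j.+1 &
    (n ^ j.+1 * #|P S| <= #|T| * max_degree H ^ j * n ^ n)%N].
  elim: j => [|j IHj] ltj.
    exists [set x0]; rewrite sub1set set11 cards1; split=> //.
    rewrite expn1 expn0 muln1 -{1}(card_ord n).
    have -> : (n ^ n = #|[set: {ffun 'I_n -> 'I_n}]|)%N by rewrite cardsT card_ffun card_ord.
    apply: (card_update (y := x0)) => [f z _|f]; first by rewrite inE.
    apply: subset_leq_card; apply/subsetP => z; rewrite !inE => /andP[].
    by rewrite ffunE eqxx.
  have [S [x0S SB Sj IH]] := IHj (ltnW ltj).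
  have SnB : S != vertices B by apply: contraTneq ltj => <-; rewrite Sj ltnn.
  have [|x [y [xS yS xyB]]] := Bconn S SB SnB; first by apply/set0Pn; exists x0.
  exists (y |: S); split; first exact: setU1r.
  - by rewrite subUset SB andbT sub1set (mem_vertices xyB) // set22.
  - by rewrite cardsU1 yS Sj.
  have step : (n * #|P (y |: S)| <= max_degree H * #|P S|)%N.
    rewrite -{1}(card_ord n); apply: (card_update (y := y)).
      move=> f z; rewrite !inE => /andP[fx0 /forallP fB].
      have updE : {in S, update f y z =1 f}.
        by move=> u uS; rewrite ffunE; case: eqP => // uy; rewrite -uy uS in yS.
      rewrite updE // fx0 /=; apply/forallP => e; apply/implyP => eB; apply/implyP => eS.
      rewrite (eq_in_imset (g := f)); last by move=> u ue; apply: updE; apply: (subsetP eS).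
      by move/implyP: (fB e) => /(_ eB) /implyP; apply; apply: subset_trans (subsetUr _ _).
    move=> f; apply: leq_trans (card_neighbours H (f x)).
    apply: subset_leq_card; apply/subsetP => z; rewrite !inE => /andP[_ /forallP/(_ [set x; y])].
    rewrite xyB subUset !sub1set setU11 (setU1r _ xS) /= imsetU1 imset_set1 !ffunE eqxx.
    by case: eqP => // xy; rewrite -xy xS in yS.
  rewrite expnSr -mulnA; apply: leq_trans (leq_mul (leqnn _) step) _.
  by rewrite mulnCA [(max_degree H ^ _)%N]expnS [(#|T| * _)%N]mulnCA
    -[X in (_ <= X)%N]mulnA leq_mul2l IH orbT.
have V0 : (0 < #|vertices B|)%N by apply/card_gt0P; exists x0.
have ltV : (#|vertices B|.-1 < #|vertices B|)%N by rewrite prednK.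
have [S [x0S SB Sj IH]] := main _ ltV.
move: IH; have -> : S = vertices B by apply/eqP; rewrite eqEcard SB Sj prednK ?leqnn.
rewrite prednK //; apply: leq_trans; rewrite leq_mul2l; apply/orP; right.
apply: subset_leq_card; apply/subsetP => f; rewrite !inE => /andP[-> fB] /=.
apply/forallP => e; apply/implyP => eB; apply/implyP => _.
by apply: (subsetP fB); apply: imset_f.
Qed.

End Growth.

(** * Copies in the complete graph, and packings *)

Section Copies.
Variable n : nat.
Implicit Types (A B H I J X Y : edgeset n) (S T V : {set 'I_n}) (s t : {perm 'I_n}).

(** [S] and its image have complements of equal size, so the map extends injectively one point at a
    time. *)
Lemma perm_extends S (f : 'I_n -> 'I_n) : {in S &, injective f} ->
  exists s, {in S, f =1 s}.
Proof.
move: {2}(n - #|S|)%N (erefl (n - #|S|)%N) => m; elim: m S f => [|m IHm] S f Sm finj.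
  have ST : S = setT.
    by apply/eqP; rewrite eqEcard subsetT cardsT card_ord -subn_eq0 Sm.
  have fi : injective f by move=> x y; apply: finj; rewrite ST inE.
  by exists (perm fi) => x _; rewrite permE.
have Sc : #|~: S| = m.+1 by rewrite [LHS]cardsCs setCK card_ord.
have fSc : #|~: (f @: S)| = m.+1.
  by rewrite [LHS]cardsCs setCK card_ord (card_in_imset finj).
have /card_gt0P[y] : (0 < #|~: S|)%N by rewrite Sc.
have /card_gt0P[z] : (0 < #|~: (f @: S)|)%N by rewrite fSc.
rewrite !inE => zfS yS.
pose g x := if x == y then z else f x.
have gE : {in S, g =1 f}.
  by move=> x xS; rewrite /g; case: eqP => // xy; rewrite -xy xS in yS.
have gy : g y = z by rewrite /g eqxx.
have [||s sE] := IHm (y |: S) g.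
- by rewrite cardsU1 yS add1n subnS Sm.
- move=> u v /setU1P[->|uS] /setU1P[->|vS] //; rewrite ?gy ?gE //.
  + by move=> zE; case/negP: zfS; rewrite zE imset_f.
  + by move=> zE; case/negP: zfS; rewrite -zE imset_f.
  + exact: finj.
by exists s => x xS; rewrite -sE ?gE // setU1r.
Qed.

Lemma image_graph_complete s I : I \subset complete n -> image_graph s I \subset complete n.
Proof.
move=> Ic; apply/subsetP => _ /imsetP[e eI ->]; rewrite inE (card_imset _ (@perm_inj _ s)).
by have := subsetP Ic e eI; rewrite inE.
Qed.

Lemma card_image_graph s I : #|image_graph s I| = #|I|.
Proof. exact/card_imset/imset_inj/perm_inj. Qed.

Lemma image_graphM s t I : image_graph (s * t)%g I = image_graph t (image_graph s I).
Proof. by rewrite -image_graph_comp; apply: eq_image_graph => x _; rewrite permM. Qed.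

Lemma image_graphK s I : image_graph s^-1%g (image_graph s I) = I.
Proof.
rewrite -image_graphM mulgV -[RHS]image_graph_id.
by apply: eq_image_graph => x _; rewrite perm1.
Qed.

Lemma image_graph_sub s A B :
  (image_graph s A \subset B) = (A \subset image_graph s^-1%g B).
Proof.
apply/idP/idP => [/(image_graphS s^-1%g)|/(image_graphS s)]; first by rewrite image_graphK.
by rewrite -{2}[s]invgK image_graphK.
Qed.

Lemma mem_image_graph s I (e : {set 'I_n}) : (s @: e \in image_graph s I) = (e \in I).
Proof. exact/mem_imset/imset_inj/perm_inj. Qed.

(** An isomorphism is injective on [vertices I] and so extends to a permutation: the copies form an
    orbit of the symmetric group. *)
Lemma copies_complete I : I \subset complete n ->
  copies I (complete n) = [set image_graph s I | s : {perm 'I_n}].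
Proof.
move=> Ic; apply/setP => J; rewrite inE; apply/andP/imsetP => [[Jc /existsP[f]]|[s _ ->]].
  case/and3P=> /forall_inP finj /eqP fV /forall_inP fE.
  have [|s sE] := @perm_extends (vertices I) f.
    by move=> x y xI yI /eqP fxy; move/forall_inP: (finj x xI) => /(_ y yI)/implyP/(_ fxy)/eqP.
  exists s => //; rewrite -(eq_image_graph sE); apply/setP => e.
  apply/idP/imsetP => [eJ|[e' e'I ->]].
    have /cards2P[a [b [ab eE]]] : #|e| == 2 by have := subsetP Jc e eJ; rewrite inE.
    have : a \in f @: vertices I by rewrite fV (mem_vertices eJ) // eE set21.
    case/imsetP=> x xI ax; have : b \in f @: vertices I by rewrite fV (mem_vertices eJ) // eE set22.
    case/imsetP=> y yI bY; exists [set x; y]; last by rewrite imsetU1 imset_set1 -ax -bY.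
    by move/forall_inP: (fE x xI) => /(_ y yI)/eqP ->; rewrite -ax -bY -eE.
  have /cards2P[a [b [ab eE]]] : #|e'| == 2 by have := subsetP Ic e' e'I; rewrite inE.
  have aI : a \in vertices I by rewrite (mem_vertices e'I) // eE set21.
  have bI : b \in vertices I by rewrite (mem_vertices e'I) // eE set22.
  by rewrite eE imsetU1 imset_set1; move/forall_inP: (fE a aI) => /(_ b bI)/eqP <-; rewrite -eE.
split; first exact: image_graph_complete.
apply/existsP; exists [ffun x => s x]; apply/and3P; split.
- apply/forall_inP => x _; apply/forall_inP => y _; rewrite !ffunE.
  by apply/implyP => /eqP/perm_inj ->.
- by rewrite vertices_image; apply/eqP/eq_imset => x; rewrite ffunE.
apply/forall_inP => x _; apply/forall_inP => y _; rewrite !ffunE.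
by rewrite -(mem_image_graph s) imsetU1 imset_set1.
Qed.

Lemma num_copies_complete_gt0 I : I \subset complete n -> (0 < num_copies I (complete n))%N.
Proof.
move=> Ic; rewrite /num_copies copies_complete //; apply/card_gt0P.
by exists (image_graph (1%g : {perm 'I_n}) I); apply: imset_f.
Qed.

Lemma num_copies_complete_le I : I \subset complete n -> I != set0 ->
  (num_copies I (complete n) <= n ^ #|vertices I|)%N.
Proof.
move=> Ic /set0Pn[e eI].
(* [i0] is a filler value off [vertices I]: a copy is determined by the images of the vertices of
   [I]. *)
have /card_gt0P[i0 _] : (0 < #|e|)%N by have := subsetP Ic e eI; rewrite inE => /eqP->.
have <- : #|pffun_on i0 (vertices I) (@predT 'I_n)| = (n ^ #|vertices I|)%N.
  by rewrite card_pffun_on card_ord.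
rewrite /num_copies copies_complete // -[X in (_ <= X)%N]cardsE.
set F := [set f in _].
apply: leq_trans (leq_imset_card (fun f : {ffun 'I_n -> 'I_n} => image_graph f I) F).
apply/subset_leq_card/subsetP => _ /imsetP[s _ ->].
apply/imsetP; exists [ffun x => if x \in vertices I then s x else i0].
  rewrite inE; apply/pffun_onP; split=> //.
  by apply/subsetP => x; rewrite inE ffunE; case: ifP; rewrite // eqxx.
by apply: eq_image_graph => x xI; rewrite ffunE xI.
Qed.

(** [k] and [I] are the size and the union of a maximal family of vertex-disjoint copies of [B] in
    [H]; [k = 0] can occur. *)
Lemma exists_packing H B : H \subset complete n -> B \subset complete n -> B != set0 ->
  cut_connected B ->
  exists k I, [/\ I \subset H, #|I| = (k * #|B|)%N,
    (num_copies I (complete n) <= 'C(n ^ #|vertices B|, k))%N &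
    (n ^ #|vertices B| * #|embeddings H B|
       <= k * #|vertices B| ^ 2 * max_degree H ^ #|vertices B|.-1 * n ^ n)%N].
Proof.
move=> Hc Bc B0 Bconn.
pose packing (P : {set edgeset n}) := (P \subset [set X in copies B (complete n) | X \subset H]) &&
  [forall X in P, forall Y in P, (X != Y) ==> [disjoint vertices X & vertices Y]].
have pack0 : packing set0 by rewrite /packing sub0set; apply/forall_inP => X; rewrite inE.
have [P /maxsetP[/andP[PH /forall_inP Pdisj] Pmax] _] := maxset_exists pack0.
have PcopyH X : X \in P -> exists2 s : {perm 'I_n}, X = image_graph s B & X \subset H.
  move/(subsetP PH); rewrite inE copies_complete // => /andP[/imsetP[s _ XE] XH].
  by exists s.
have Pd X Y : X \in P -> Y \in P -> X != Y -> [disjoint vertices X & vertices Y].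
  by move=> XP YP XY; move/forall_inP: (Pdisj X XP) => /(_ Y YP)/implyP/(_ XY).
pose I := cover P.
have IH : I \subset H by apply/bigcupsP => X /PcopyH[].
have Ic : I \subset complete n by exact: subset_trans Hc.
exists #|P|, I; split=> //.
(* Sharing no vertex, the packed copies share no edge, so their sizes add up. *)
- have : trivIset P.
    apply/trivIsetP => X Y XP YP XY; rewrite disjoints_subset; apply/subsetP => e eX.
    rewrite inE; apply/negP => eY.
    have : e \in complete n by apply: (subsetP Hc); have [s _ /subsetP] := PcopyH X XP; apply.
    rewrite inE => /cards2P[a [b [_ eE]]].
    have := disjointFr (Pd X Y XP YP XY) (x := a).
    rewrite !(mem_vertices (e := e)) ?eE ?set21 -?eE //.
    by move=> /(_ isT).
  rewrite /trivIset => /eqP <-; rewrite -sum_nat_const; apply: eq_bigr => X /PcopyH[s -> _].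
  exact: card_image_graph.
(* A copy of [I] is the union of [k] distinct copies of [B], so it comes from a [k]-subset of the
   copies of [B]. *)
- apply: leq_trans (leq_bin2l _ (num_copies_complete_le Bc B0)).
  rewrite -cards_draws; set D := [set Q | _ & _].
  apply: leq_trans (leq_imset_card (@cover _) D).
  rewrite /num_copies copies_complete //; apply/subset_leq_card/subsetP => _ /imsetP[s _ ->].
  apply/imsetP; exists [set image_graph s X | X in P].
    rewrite inE card_imset ?eqxx ?andbT; last first.
      by apply: imset_inj; apply: imset_inj; apply: perm_inj.
    apply/subsetP => _ /imsetP[X /PcopyH[t -> _] ->].
    by rewrite copies_complete //; apply/imsetP; exists (t * s)%g; rewrite ?image_graphM.
  by rewrite cover_imset /image_graph imset_cover.
pose U := \bigcup_(X in P) vertices X.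
have cardU : (#|U| <= #|P| * #|vertices B|)%N.
  apply: leq_trans (card_big_setU _ _ _) _.
  rewrite -sum_nat_const leq_sum // => X /PcopyH[s -> _].
  by rewrite vertices_image leq_imset_card.
pose F x := [set f : {ffun 'I_n -> 'I_n} | (f x \in U) && (image_graph f B \subset H)].
(* Every embedding sends some vertex of [B] into [U]: by maximality, an image avoiding [U] would
   already belong to [P]. *)
have embF : embeddings H B \subset \bigcup_(x in vertices B) F x.
  apply/subsetP => f; rewrite inE => /andP[/imset_injP finj fB].
  have [s sE] := perm_extends finj.
  pose X := image_graph s B; have XE : X = image_graph f B by apply/esym/eq_image_graph.
  have XH : X \subset H by rewrite XE.
  have [|] := boolP [disjoint f @: vertices B & U]; last first.
    case/pred0Pn => y /andP[/imsetP[x xB ->] fxU].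
    by apply/bigcupP; exists x => //; rewrite inE fB andbT.
  rewrite -vertices_image -XE => dXU.
  have dX Y : Y \in P -> [disjoint vertices X & vertices Y].
    move=> YP; apply: disjointWr dXU; exact: bigcup_sup.
  have XP : X \in P.
    suff <- : X |: P = P by rewrite setU11.
    apply: Pmax; last exact: subsetUr.
    apply/andP; split.
      rewrite subUset PH andbT sub1set inE XH andbT copies_complete //; exact: imset_f.
    apply/forall_inP => Y /setU1P[->|YP]; apply/forall_inP => Z /setU1P[->|ZP]; apply/implyP.
    - by rewrite eqxx.
    - by move=> _; apply: dX.
    - by move=> _; rewrite disjoint_sym; apply: dX.
    - exact: Pd.
  (* Now [X] is disjoint from itself, although [B] has an edge. *)
  have := dX X XP; rewrite -setI_eq0 setIid XE vertices_image => /eqP V0.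
  have /set0Pn[e eB] := B0.
  have /cards2P[a [b [_ eE]]] : #|e| == 2 by have := subsetP Bc e eB; rewrite inE.
  have : f a \in f @: vertices B by rewrite imset_f // (mem_vertices eB) // eE set21.
  by rewrite V0 inE.
(* Union bound over the vertex of [B] landing in [U], with [T := U] in the exploration. The two
   factors [#|vertices B|] come from this sum and from [#|U|]. *)
apply: leq_trans (leq_mul (leqnn _) (leq_trans (subset_leq_card embF) (card_big_setU _ _ _))) _.
rewrite big_distrr /=.
have -> : (#|P| * #|vertices B| ^ 2 * max_degree H ^ #|vertices B|.-1 * n ^ n =
  \sum_(x in vertices B) (#|P| * #|vertices B| * max_degree H ^ #|vertices B|.-1 * n ^ n))%N.
  by rewrite sum_nat_const -mulnn !mulnA [(#|P| * _)%N]mulnC.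
apply: leq_sum => x xB; apply: leq_trans (homs_growth _ _ Bconn xB) _.
by rewrite !leq_mul2r cardU !orbT.
Qed.

End Copies.

(** * Estimates for falling factorials and binomials *)

Section Bounds.
Variable R : realType.
Implicit Types (a b x : R).

Lemma expR1_ge1 : 1 <= expR 1 :> R.
Proof. by rewrite -[X in X <= _]expR0 ler_expR ler01. Qed.

(** Induction on [v], removing the leading factor, reduces this to [(m + 1) ^ v <= e m ^ v] for
    [v <= m], which follows from [(1 + 1/m) ^ v <= exp(v/m)]. *)
Lemma exprn_le_expr_ffact m v : (v <= m)%N ->
  m%:R ^+ v <= expR 1 ^+ v * (m ^_ v)%:R :> R.
Proof.
elim: v m => [|v IHv] [|m] //; rewrite ?ffactn0 ?expr0 ?mulr1 // ltnS => vm.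
have step : m.+1%:R ^+ v <= expR 1 * m%:R ^+ v :> R.
  case: m vm => [|m] vm.
    by move: vm; rewrite leqn0 => /eqP->; rewrite !expr0 mulr1 expR1_ge1.
  have m0 : 0 < m.+1%:R :> R by rewrite ltr0n.
  have -> : m.+2%:R = m.+1%:R * (1 + m.+1%:R^-1) :> R.
    by rewrite mulrDr mulr1 divff ?gt_eqF // -natr1.
  rewrite exprMn mulrC ler_wpM2r ?exprn_ge0 ?ler0n //.
  apply: le_trans (_ : expR m.+1%:R^-1 ^+ v <= _).
    by rewrite lerXn2r ?nnegrE ?addr_ge0 ?invr_ge0 ?expR_ge0 ?ler01 // expR_ge1Dx.
  by rewrite -expRM_natl ler_expR ler_pdivrMr // mul1r ler_nat.
rewrite ffactSS natrM exprS mulrCA [_ ^+ v.+1]exprS.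
apply: ler_wpM2l; first by rewrite ler0n.
by apply: le_trans step _; rewrite -mulrA ler_wpM2l ?expR_ge0 ?IHv.
Qed.

Lemma ffact_leq_expn m k : (m ^_ k <= m ^ k)%N.
Proof. by elim: k => // k IHk; rewrite ffactnSr expnSr leq_mul // leq_subr. Qed.

(** This is ['C(m, k) <= (e m / k) ^ k] with the denominator cleared; it rests on
    [k ^ k <= e ^ k k!]. *)
Lemma expr_mul_bin_le m k : k%:R ^+ k * 'C(m, k)%:R <= expR 1 ^+ k * m%:R ^+ k :> R.
Proof.
apply: le_trans (ler_wpM2r (ler0n _ _) (exprn_le_expr_ffact (leqnn k))) _.
rewrite ffactnn -mulrA -natrM [(k`! * _)%N]mulnC bin_ffact ler_wpM2l ?exprn_ge0 ?expR_ge0 //.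
by rewrite -natrX ler_nat ffact_leq_expn.
Qed.

(** Roots are avoided below by comparing suitable integer powers. *)
Lemma expr_root_le k a b : (0 < k)%N -> 0 <= a -> 0 <= b -> a ^+ k <= b ^+ k -> a <= b.
Proof. by move=> k0 a0 b0; rewrite ler_pXn2r ?nnegrE. Qed.

End Bounds.

(** * Bounding embeddings by [q] and [Q] *)

Section Spread.
Variables (R : realType) (n : nat).
Implicit Types (A B H I J : edgeset n) (s t : {perm 'I_n}).

Lemma q_ge0 H : 0 <= q R H.
Proof.
rewrite /q; elim/big_ind : _ => // [x y x0 y0|I _]; last exact: powR_ge0.
by rewrite le_max x0.
Qed.

Lemma q_expr_ge H I : I \subset H -> I != set0 ->
  (num_copies I (complete n))%:R^-1 <= q R H ^+ #|I|.
Proof.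
move=> IH I0; set N := (num_copies _ _)%:R : R.
have I0R : #|I|%:R != 0 :> R by rewrite pnatr_eq0 cards_eq0.
have -> : N^-1 = (N `^ (- #|I|%:R^-1)) ^+ #|I|.
  by rewrite -powR_mulrn ?powR_ge0 // -powRrM mulNr mulVf // powR_inv1 ?ler0n.
rewrite lerXn2r ?nnegrE ?powR_ge0 ?q_ge0 //.
apply: (le_bigmax_cond _ (fun I => (num_copies I (complete n))%:R `^ (- #|I|%:R^-1) : R)).
by rewrite IH I0.
Qed.

Lemma max_avg_degree_attained H : H != set0 -> exists J, [/\ J \subset H, J != set0 &
  max_avg_degree R H = (2 * #|J|)%:R / #|vertices J|%:R].
Proof.
move=> H0.
have [||J JP E] := @eq_bigmax _ R _ 0 H (fun J => (J \subset H) && (J != set0))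
  (fun J => (2 * #|J|)%:R / #|vertices J|%:R : R).
- by rewrite subxx H0.
- by move=> J _; rewrite divr_ge0 ?ler0n.
by case/andP: JP => JH J0; exists J.
Qed.

Lemma vertices_gt0 A : A \subset complete n -> A != set0 -> (0 < #|vertices A|)%N.
Proof.
move=> Ac /set0Pn[e eA]; have := subsetP Ac e eA; rewrite inE => /cards2P[a [b [_ eE]]].
by apply/card_gt0P; exists a; rewrite (mem_vertices eA) // eE set21.
Qed.

(** The [Q] of the overview: the claimed spread without its constant. *)
Definition spread_rate H : R := (max_degree H)%:R `^ (2 / max_avg_degree R H) * q R H.

Lemma spread_rate_ge0 H : 0 <= spread_rate H.
Proof. by rewrite mulr_ge0 ?powR_ge0 ?q_ge0. Qed.

(** For a densest [J] the exponent [2/d] is [v(J)/e(J)], so the power [e(J)] leaves integer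
    exponents only. *)
Lemma spread_rate_exprE H : H \subset complete n -> H != set0 ->
  exists J, [/\ J \subset H, J != set0 &
  spread_rate H ^+ #|J| = (max_degree H)%:R ^+ #|vertices J| * q R H ^+ #|J|].
Proof.
move=> Hc H0; have [J [JH J0 dE]] := max_avg_degree_attained H0.
exists J; split=> //; rewrite exprMn; congr (_ * _).
have J0R : #|J|%:R != 0 :> R by rewrite pnatr_eq0 cards_eq0.
have V0R : #|vertices J|%:R != 0 :> R.
  by rewrite pnatr_eq0 -lt0n vertices_gt0 // (subset_trans JH).
rewrite -!powR_mulrn ?powR_ge0 ?ler0n // -powRrM dE natrM; congr (_ `^ _).
by field; rewrite J0R V0R.
Qed.

Lemma embeddings_component_bound H B : H \subset complete n -> B \subset complete n -> B != set0 ->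
  cut_connected B -> H != set0 ->
  #|embeddings H B|%:R <= (16 * expR 1 * spread_rate H) ^+ #|B| * n%:R ^+ n.
Proof.
move=> Hc Bc B0 Bconn H0; set Q := spread_rate H; set D := max_degree H.
set v := #|vertices B|; set e := expR 1 : R.
have e1 : 1 <= e by exact: expR1_ge1.
have e0 : 0 <= e by exact: le_trans e1.
have D0 : (0 < D)%N by exact: max_degree_gt0.
have Dn : (D <= n)%N by exact: max_degree_le.
have v0 : (0 < v)%N by exact: vertices_gt0.
have vB : (v <= 2 * #|B|)%N by exact: vertices_le.
have n0N : (0 < n)%N by exact: leq_trans Dn.
have n0 : 0 < n%:R :> R by rewrite ltr0n.
have D0R : 0 < D%:R :> R by rewrite ltr0n.
have Q0 : 0 <= Q by exact: spread_rate_ge0.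
have q0 : 0 <= q R H by exact: q_ge0.
have nv0 : 0 < n%:R ^+ v :> R by rewrite exprn_gt0.
have c1 : 1 <= 16 * e by apply: le_trans e1 _; rewrite ler_peMl // ler1n.
have c0 : 0 <= 16 * e * Q by rewrite (mulr_ge0 (le_trans ler01 c1)).
have [J [JH J0 QJ]] := spread_rate_exprE Hc H0.
have eJ0 : (0 < #|J|)%N by rewrite card_gt0.
have Jc := subset_trans JH Hc.
(* With [d = 2 e(J) / v(J)], [dense] says that [v - 1 <= 2 e(B) / d]. *)
have [dense|sparse] := leqP (v.-1 * #|J|) (#|B| * #|vertices J|).
  (* Powers [#|J|] are compared: as [D >= 1], [dense] settles the exponents of [D]. *)
  have QB : D%:R ^+ v.-1 * q R H ^+ #|B| <= Q ^+ #|B|.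
    apply: (expr_root_le eJ0); rewrite ?mulr_ge0 ?exprn_ge0 ?ler0n //.
    rewrite exprAC QJ !exprMn [X in _ <= _ * X]exprAC ler_wpM2r ?exprn_ge0 //.
    by rewrite -!exprM mulnC [(_ * #|B|)%N]mulnC ler_weXn2l // ?ler1n // mulnC.
  have [k [I [IH Icard Icopies]]] := exists_packing Hc Bc B0 Bconn.
  rewrite -/v -/D -(ler_nat R) !natrM !natrX => emb.
  (* For [k = 0] the packing bound leaves no embedding at all. *)
  have [k0|k0] := posnP k.
    move: emb; rewrite k0 !mul0r pmulr_rle0 // => /le_trans; apply.
    by apply: mulr_ge0; apply: exprn_ge0.
  have I0 : I != set0 by rewrite -card_gt0 Icard muln_gt0 k0 card_gt0.
  (* [q] is tested on the packing [I], with [k * #|B|] edges and at most [(e n^v / k)^k] copies;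
     then a [k]-th root is taken. *)
  have qB : k%:R / (e * n%:R ^+ v) <= q R H ^+ #|B|.
    apply: (expr_root_le k0); rewrite ?divr_ge0 ?mulr_ge0 ?exprn_ge0 ?ler0n //.
    rewrite -exprM mulnC -Icard; apply: le_trans (q_expr_ge IH I0).
    have NI0 : 0 < (num_copies I (complete n))%:R :> R.
      by rewrite ltr0n num_copies_complete_gt0 // (subset_trans IH).
    rewrite expr_div_n ler_pdivrMr ?exprn_gt0 ?mulr_gt0 ?expR_gt0 //.
    rewrite mulrC ler_pdivlMr // exprMn -natrX.
    apply: le_trans (expr_mul_bin_le R (n ^ v) k); rewrite ler_wpM2l ?exprn_ge0 ?ler0n //.
    by rewrite ler_nat.
  rewrite -(ler_pM2l nv0); apply: le_trans emb _.
  (* Source of the constant: [v ^ 2 <= 4 ^ v <= 16 ^ #|B|], since [v <= 2 * #|B|]. *)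
  have v16 : e * v%:R ^+ 2 <= (16 * e) ^+ #|B|.
    rewrite exprMn mulrC ler_pM ?exprn_ge0 ?ler0n //.
      rewrite -!natrX ler_nat; apply: (@leq_trans (4 ^ v)).
        by rewrite -[4%N]/(2 ^ 2)%N expnAC leq_exp2r // ltnW // ltn_expl.
      by rewrite -[16%N]/(4 ^ 2)%N -expnM leq_pexp2l.
    by rewrite -[X in X <= _]expr1 ler_weXn2l // card_gt0.
  have kq : k%:R <= e * n%:R ^+ v * q R H ^+ #|B|.
    by rewrite mulrC -ler_pdivrMr // mulr_gt0 ?expR_gt0.
  rewrite [leRHS]mulrA ler_wpM2r ?exprn_ge0 ?ler0n //.
  apply: le_trans (_ : n%:R ^+ v * (e * v%:R ^+ 2) *
    (D%:R ^+ v.-1 * q R H ^+ #|B|) <= _); last first.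
    rewrite -mulrA ler_wpM2l ?exprn_ge0 ?ler0n // exprMn.
    by rewrite ler_pM ?mulr_ge0 ?exprn_ge0 ?ler0n.
  have rearr (x1 x2 x3 x4 x5 : R) : x1 * (x2 * x3) * (x4 * x5) = x2 * x1 * x5 * x3 * x4.
    by ring.
  by rewrite rearr !ler_wpM2r ?exprn_ge0 ?mulr_ge0 ?ler0n.
have r0 : 0 <= D%:R / n%:R :> R by rewrite divr_ge0 ?ler0n.
have r1 : D%:R / n%:R <= 1 :> R by rewrite ler_pdivrMr // mul1r ler_nat.
(* Here [q] is tested on the densest [J], which has at most [n ^ v(J)] copies, so
   [Q ^ e(J) >= (D/n) ^ v(J)]. As [D/n <= 1], [sparse] settles the exponents. *)
have QB : (D%:R / n%:R) ^+ v.-1 <= Q ^+ #|B|.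
  apply: (expr_root_le eJ0); rewrite ?exprn_ge0 //.
  apply: le_trans (_ : ((D%:R / n%:R) ^+ #|vertices J|) ^+ #|B| <= _).
    by rewrite -!exprM ler_wiXn2l // mulnC ltnW.
  rewrite [leRHS]exprAC QJ lerXn2r ?nnegrE ?mulr_ge0 ?exprn_ge0 ?ler0n //.
  rewrite expr_div_n ler_wpM2l ?exprn_ge0 ?ler0n //; apply: le_trans (q_expr_ge JH J0).
  rewrite lef_pV2 ?posrE ?exprn_gt0 ?ltr0n ?num_copies_complete_gt0 //.
  by rewrite -natrX ler_nat num_copies_complete_le.
have [x0 x0B] : exists x0, x0 \in vertices B by apply/card_gt0P.
have := homs_growth H setT Bconn x0B; set F := [set f | _].
have embF : embeddings H B \subset F.
  by apply/subsetP => f; rewrite !inE => /andP[_ ->].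
move=> /(leq_trans (leq_mul (leqnn _) (subset_leq_card embF))).
rewrite -/v -/D cardsT card_ord -(ler_nat R) !natrM !natrX => emb.
rewrite -(ler_pM2l nv0); apply: le_trans emb _.
rewrite [leRHS]mulrA ler_wpM2r ?exprn_ge0 ?ler0n //.
apply: le_trans (_ : n%:R ^+ v * (D%:R / n%:R) ^+ v.-1 <= _).
  rewrite -{2}(prednK v0) exprS expr_div_n; set y := n%:R ^+ v.-1.
  have y0 : y != 0 by rewrite gt_eqF // exprn_gt0.
  by rewrite mulrACA divff // mulr1.
rewrite ler_wpM2l ?exprn_ge0 ?ler0n //; apply: le_trans QB _.
by rewrite [leRHS]exprMn ler_peMl ?exprn_ge0 // exprn_ege1.
Qed.

(** Induction on the number of edges, splitting off one component: over vertex-disjoint parts [t] is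
    submultiplicative and the bound multiplicative. *)
Lemma embeddings_bound H A : H \subset complete n -> H != set0 -> A \subset complete n ->
  #|embeddings H A|%:R <= (16 * expR 1 * spread_rate H) ^+ #|A| * n%:R ^+ n.
Proof.
move=> Hc H0; have [m] := ubnP #|A|; elim: m A => // m IHm A; rewrite ltnS => Am Ac.
have n0 : 0 < n%:R ^+ n :> R.
  by rewrite exprn_gt0 // ltr0n (leq_trans (max_degree_gt0 Hc H0)) ?max_degree_le.
have [->|A0] := eqVneq A set0.
  rewrite cards0 expr0 mul1r -natrX ler_nat.
  have -> : (n ^ n = #|[set: {ffun 'I_n -> 'I_n}]|)%N by rewrite cardsT card_ffun card_ord.
  exact/subset_leq_card/subsetT.
have [B [BA B0 Bconn dB]] := exists_component Ac A0.
have cardA : (#|B| + #|A :\: B| = #|A|)%N by rewrite -(cardsID B A) (setIidPr BA).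
have := embeddings_disjoint H dB.
have -> : B :|: A :\: B = A by rewrite -{1}(setIidPr BA) setID.
rewrite -(ler_nat R) !natrM natrX => emb.
rewrite -(ler_pM2l n0); apply: le_trans emb _.
rewrite -cardA exprD.
apply: le_trans (ler_pM _ _ (embeddings_component_bound Hc (subset_trans BA Ac) B0 Bconn H0)
   (IHm (A :\: B) _ _)) _; rewrite ?ler0n //.
- by rewrite (leq_trans _ Am) // -cardA -add1n leq_add2r card_gt0.
- by rewrite (subset_trans (subsetDl _ _)).
- by rewrite [leLHS]mulrACA [leLHS]mulrA [leLHS]mulrC.
Qed.

(** * Random copies as images under random permutations *)

Lemma card_perm_copies H (F : {set edgeset n}) : H \subset complete n ->
  F \subset copies H (complete n) ->
  #|[set s : {perm 'I_n} | image_graph s H \in F]|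
    = (#|F| * #|[set s : {perm 'I_n} | image_graph s H == H]|)%N.
Proof.
move=> Hc FH; rewrite -sum1dep_card.
rewrite (partition_big (fun s : {perm 'I_n} => image_graph s H) (mem F)) //= -sum_nat_const.
apply: eq_bigr => S SF; rewrite sum1dep_card.
(* Orbit-stabiliser: if [t] carries [H] to [S], the permutations doing so form the coset through [t]
   of the stabiliser of [H]. *)
have := subsetP FH _ SF; rewrite copies_complete // => /imsetP[t _ SE].
rewrite -[RHS](card_imset _ (mulIg t)); apply: eq_card => s; rewrite inE.
apply/idP/imsetP => [/andP[_ /eqP sE]|[u]].
  exists (s * t^-1)%g; last by rewrite mulgKV.
  by rewrite inE image_graphM sE SE image_graphK.
by rewrite inE => /eqP uH ->; rewrite image_graphM uH -SE eqxx andbT.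
Qed.

(** A uniform copy is the image of [H] under a uniform permutation [s], and it contains [A] exactly
    when the inverse of [s] maps [A] into [H]. *)
Lemma nu_superset_sum H A : H \subset complete n ->
  \sum_(S : edgeset n | A \subset S) nu R H S <= #|inj_homs H setT A|%:R / n`!%:R.
Proof.
move=> Hc; pose F := [set S in copies H (complete n) | A \subset S].
set N := num_copies H (complete n).
have -> : \sum_(S : edgeset n | A \subset S) nu R H S = #|F|%:R / N%:R.
  rewrite /nu -big_mkcondr /= mulr_natl -/N -[RHS]sumr_const.
  by apply: eq_bigl => S; rewrite [RHS]inE andbC.
have stab0 : (0 < #|[set s : {perm 'I_n} | image_graph s H == H]|)%N.
  apply/card_gt0P; exists 1%g; rewrite inE -[X in _ == X]image_graph_id; apply/eqP.
  by apply: eq_image_graph => x _; rewrite perm1.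
have N0 : (0 < N)%N by exact: num_copies_complete_gt0.
rewrite ler_pdivrMr ?ltr0n // mulrAC ler_pdivlMr ?ltr0n ?fact_gt0 // -!natrM ler_nat.
have factE : (n`! = N * #|[set s : {perm 'I_n} | image_graph s H == H]|)%N.
  rewrite -card_Sn -card_perm_copies //; apply: eq_card => s.
  by rewrite [RHS]inE copies_complete //; apply/esym/imsetP; exists s.
rewrite factE mulnCA mulnC leq_mul2r; apply/orP; right.
rewrite -card_perm_copies //; last by apply/subsetP => S; rewrite inE => /andP[].
pose h (s : {perm 'I_n}) : {ffun 'I_n -> 'I_n} := [ffun x => s^-1%g x].
have hinj : injective h.
  move=> s t /ffunP st; apply: invg_inj; apply/permP => x.
  by have := st x; rewrite !ffunE.
rewrite -(card_imset _ hinj); apply/subset_leq_card/subsetP => _ /imsetP[s sF ->].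
move: sF; rewrite !inE => /andP[_ AS]; apply/andP; split.
  apply/eqP/card_imset => x y; rewrite !ffunE; exact: perm_inj.
rewrite (eq_image_graph (g := s^-1%g)); last by move=> x _; rewrite ffunE.
by rewrite image_graph_sub invgK.
Qed.

Lemma nu_probability H : H \subset complete n -> is_probability (nu R H).
Proof.
move=> Hc; split=> [S|S Sc|].
- by rewrite /nu; case: ifP => // _; rewrite invr_ge0 ler0n.
- by rewrite /nu inE (negPf Sc).
rewrite /nu -big_mkcond /= sumr_const -[LHS]mulr_natl divff //.
by rewrite pnatr_eq0 -lt0n num_copies_complete_gt0.
Qed.

End Spread.

(** * Assembling the spread bound *)

Theorem theorem1p2 (R : realType) :
  exists C : R, 0 < C /\
    forall (n : nat) (H : edgeset n),
      H \subset complete n -> H != set0 ->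
      spread (C * ((max_degree H)%:R `^ (2 / max_avg_degree R H)) * q R H)
             (nu R H).
Proof.
(* The factor [16 * expR 1] comes from counting embeddings; [expR 1 ^+ 2] per edge pays for passing
   from random maps to permutations. *)
exists (expR 1 ^+ 2 * (16 * expR 1)); split.
  by rewrite !mulr_gt0 ?exprn_gt0 ?expR_gt0.
move=> n H Hc H0; split=> [|A Ac A0]; first exact: nu_probability.
apply: le_trans (nu_superset_sum R A Hc) _.
rewrite -mulrA -/(spread_rate R H) -mulrA exprMn.
set X := (_ * spread_rate R H) ^+ _.
have X0 : 0 <= X by rewrite exprn_ge0 // mulr_ge0 ?spread_rate_ge0 // mulr_ge0 ?expR_ge0.
have emb := embeddings_bound R Hc H0 Ac.
have := inj_homs_setT H A; set v := #|vertices A|.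
rewrite -(ler_nat R) !natrM natrX => inj.
have vn : (v <= n)%N by rewrite -[X in (_ <= X)%N]card_ord max_card.
have n0 : 0 < n%:R :> R.
  by rewrite ltr0n (leq_trans (max_degree_gt0 Hc H0)) ?max_degree_le.
(* [n!] splits as [n ^_ v] times [(n - v)!], and the latter cancels against [inj]. *)
rewrite ler_pdivrMr ?ltr0n ?fact_gt0 // -(ffact_fact vn) natrM.
rewrite -(ler_pM2l (exprn_gt0 (n - v) n0)); apply: le_trans inj _.
have rearr (a b x c f : R) : a * (b * x * (c * f)) = f * (a * (x * (b * c))) by ring.
rewrite rearr ler_wpM2l ?ler0n //; apply: le_trans emb _.
rewrite -/X -{2}(subnK vn) exprD [leLHS]mulrCA ler_wpM2l ?exprn_ge0 ?ler0n // ler_wpM2l //.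
(* [n ^ v <= e ^ v n ^_ v], and [v <= 2 * #|A|] turns [e ^ v] into [e ^ 2] per edge. *)
apply: le_trans (exprn_le_expr_ffact R vn) _; rewrite ler_wpM2r ?ler0n //.
by rewrite -exprM; apply: ler_weXn2l; [exact: expR1_ge1 | exact: vertices_le].
Qed.
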